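(* Let $a,k,d,e,f$ be integers with $1\le a\le k$, $1\le d\le k$, $1\le f\le d$, and either $e=d$ or $2e=d$. Let ${}_dB_{dk+e,\,da+f}(n)$ be the number of partitions of $n$ such that $$\phi_i+\phi_{i+1}<dk+e \ \text{ for all } i\ge 1,\qquad \phi_1<da+f,\qquad d\mid \phi_{2i}\ \text{ for all } i\ge 1.$$ Put $M=2dk+2e+d$. Then $\sum_{n\ge 0}{}_dB_{dk+e,\,da+f}(n)\,q^n$ equals: - if $f<e$: $$\frac{1}{(q^{2d};q^{2d})_\infty (q;q^2)_\infty}\left(\frac{1-q^{d-e+f}}{1-q^d}\,(q^{da+e},q^{2dk-da+e+d},q^{M};q^{M})_\infty+\frac{q^{d-e+f}-q^d}{1-q^d}\,(q^{d(a-1)+e},q^{2dk-da+e+2d},q^{M};q^{M})_\infty\right);$$ - if $f=e$: $$\frac{(q^{da+e},q^{2dk-da+e+d},q^{M};q^{M})_\infty}{(q^{2d};q^{2d})_\infty (q;q^2)_\infty};$$ - if $f>e$: $$\frac{1}{(q^{2d};q^{2d})_\infty (q;q^2)_\infty}\left(\frac{q^{f-e}-q^d}{1-q^d}\,(q^{da+e},q^{2dk-da+e+d},q^{M};q^{M})_\infty+\frac{1-q^{f-e}}{1-q^d}\,(q^{d(a+1)+e},q^{2dk-da+e},q^{M};q^{M})_\infty\right).$$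
   Context: A partition of a nonnegative integer $n$ is a finite non-increasing sequence of positive integers summing to $n$ (the empty partition is the unique partition of $0$). For a partition and an integer $i\ge1$, $\phi_i$ denotes the number of times $i$ occurs as a part (so $\phi_i\ge 0$). For $|q|<1$: $(a;q)_n=(1-a)(1-aq)\cdots(1-aq^{n-1})$, $(a;q)_\infty=\lim_{n\to\infty}(a;q)_n$, and $(a_1,\dots,a_r;q)_\infty=(a_1;q)_\infty\cdots(a_r;q)_\infty$. The identity is of formal power series in $q$ (equivalently of analytic functions for $|q|<1$). *)

(* Defs.v *)
From HB Require Import structures.
From mathcomp Require Import all_boot all_order all_algebra.
Set Implicit Arguments. Unset Strict Implicit. Unset Printing Implicit Defensive.
Import Order.TTheory GRing.Theory Num.Theory.
Local Open Scope ring_scope.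

(* formal power series in q with rational coefficients: n |-> coefficient of q^n *)
Definition ps := nat -> rat.

Definition psadd (f g : ps) : ps := fun n => f n + g n.
Definition psmul (f g : ps) : ps := fun n => \sum_(i < n.+1) f i * g (n - i)%N.
Definition pspoly (p : {poly rat}) : ps := fun n => p`_n.

(* multiplicative inverse of a power series with nonzero constant term:
   g_0 = 1/f_0,  g_n = -(1/f_0) * sum_{i=1..n} f_i g_{n-i}.
   psinv_seq f n = [:: g_0; ...; g_n]. *)
Fixpoint psinv_seq (f : ps) (n : nat) : seq rat :=
  match n with
  | 0 => [:: (f 0%N)^-1]
  | n'.+1 => let s := psinv_seq f n' in
      rcons s (- (f 0%N)^-1 * \sum_(i < n'.+1) f i.+1 * nth 0 s (n' - i)%N)
  end.
Definition psinv (f : ps) : ps := fun n => nth 0 (psinv_seq f n) n.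

(* (q^c ; q^m)_infty = prod_{j>=0} (1 - q^(c + j m)) as a formal power series.
   For c >= 1 and m >= 1, the factors with j > n do not affect the
   coefficient of q^n, so that coefficient is read off the finite product
   (q^c;q^m)_{n+1}. *)
Definition qpinf (c m : nat) : ps :=
  fun n => (\prod_(j < n.+1) (1 - 'X^(c + j * m)%N) : {poly rat})`_n.

Definition qp3 (c1 c2 m : nat) : ps :=
  psmul (qpinf c1 m) (psmul (qpinf c2 m) (qpinf m m)).

Definition is_partition (n : nat) (s : seq nat) : Prop :=
  sorted geq s /\ all (fun x => 0 < x)%N s /\ sumn s = n.

Definition phi (s : seq nat) (i : nat) : nat := count_mem i s.

Definition dB_cond (d K L : nat) (s : seq nat) : Prop :=
  (forall i, (1 <= i)%N -> (phi s i + phi s i.+1 < K)%N) /\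
  (phi s 1 < L)%N /\
  (forall i, (1 <= i)%N -> (d %| phi s (2 * i))%N).

(* Main.v *)
Require Import Defs.
From mathcomp Require Import all_boot all_order all_algebra.
From mathcomp Require Import ring zify.
From Stdlib Require Import Setoid Morphisms.
Set Implicit Arguments. Unset Strict Implicit. Unset Printing Implicit Defensive.
Import GRing.Theory.
Local Open Scope ring_scope.

(** Put K = dk + e and let A(N, S) be the generating function of the partitions with all
    parts > N, phi_i + phi_{i+1} < K, phi_{N+1} < S and d | phi_{2i}. Removing the parts
    N + 1 expresses A(N, S) through the A(N + 1, K - i), i < S. With
    D = (q^{2d}; q^{2d})_oo (q; q^2)_oo and w(N) the product of (1 - q^{di}) / (1 - q^i)
    over the odd i <= N, the series D w(N) A(N, S), for S = da + e (N even) or S = da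
    (N odd), satisfy the recurrences
      F(N, S + d) = F(N, S) + q^{(N+1)S} F(N + 1, K - S),
      F(N, -S) = - q^{-(N+1)S} F(N, S)
    of Andrews' functions J_{K/d, S/d}(q^{dN}; q^d), multiplied by (q^d; q^d)_oo. Both
    sides agree in the limit N -> oo, hence for all N, and at N = 0 the Jacobi triple
    product turns the theta series F(0, da + e) into the infinite product. For f <> e, the
    generating function A(0, da + f) is interpolated linearly between two neighbouring
    A(0, da' + e). Power series identities are proved as polynomial identities modulo q^T,
    where a bound on the parts makes A(N, S) a polynomial. *)

Definition eqmodX (R : nzRingType) (T : nat) (p q : {poly R}) : Prop :=
  forall i, (i < T)%N -> p`_i = q`_i.

Notation "p = q %[modX T ]" := (eqmodX T p q)
  (at level 70, q at next level, format "'[hv ' p '/'  =  q '/'  %[modX  T ] ']'") :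
  ring_scope.

#[export] Instance eqmodX_equiv (R : nzRingType) T : Equivalence (@eqmodX R T).
Proof.
split=> [p i //|p q pq i iT|p q r pq qr i iT]; first by rewrite pq.
by rewrite pq // qr.
Qed.

#[export] Instance eqmodX_add (R : nzRingType) T :
  Proper (@eqmodX R T ==> @eqmodX R T ==> @eqmodX R T) +%R.
Proof. by move=> p p' pp q q' qq i iT; rewrite !coefD pp // qq. Qed.

#[export] Instance eqmodX_opp (R : nzRingType) T :
  Proper (@eqmodX R T ==> @eqmodX R T) -%R.
Proof. by move=> p p' pp i iT; rewrite !coefN pp. Qed.

#[export] Instance eqmodX_mul (R : nzRingType) T :
  Proper (@eqmodX R T ==> @eqmodX R T ==> @eqmodX R T) *%R.
Proof.
move=> p p' pp q q' qq i iT; rewrite !coefM; apply: eq_bigr => j _.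
by rewrite pp ?qq //; have := ltn_ord j; lia.
Qed.

Section CongruenceModX.
Variables (R : nzRingType) (T : nat).
Implicit Types (p q u : {poly R}) (E : nat -> {poly R}).

Lemma eqmodXW p q : p = q -> p = q %[modX T].
Proof. by move->. Qed.

Lemma eqmodX_sum (I : Type) (r : seq I) (P : pred I) (E E' : I -> {poly R}) :
  (forall i, P i -> E i = E' i %[modX T]) ->
  \sum_(i <- r | P i) E i = \sum_(i <- r | P i) E' i %[modX T].
Proof.
move=> EE'; elim/big_ind2: _ => // p p' q q' pp qq.
by rewrite pp qq.
Qed.

Lemma eqmodX_sum_trunc E n : (T <= n)%N ->
  (forall i, (T <= i)%N -> E i = 0 %[modX T]) ->
  \sum_(i < n) E i = \sum_(i < T) E i %[modX T].
Proof.
move=> Tn E0; rewrite -(subnKC Tn) big_split_ord /= -[X in _ = X %[modX _]]addr0.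
apply: eqmodX_add => //; transitivity (\sum_(i < n - T) 0 : {poly R}).
  by apply: eqmodX_sum => i _; apply: E0; rewrite leq_addr.
by rewrite big1.
Qed.

Lemma eqmodX_Xn0 n p : (T <= n)%N -> 'X^n * p = 0 %[modX T].
Proof. by move=> Tn i iT; rewrite coefXnM coef0 ifT //; lia. Qed.

Lemma eqmodX_mulI u p q :
  GRing.lreg u`_0 -> u * p = u * q %[modX T] -> p = q %[modX T].
Proof.
move=> u_reg upq; elim/ltn_ind=> i IH iT; apply: u_reg.
have := upq i iT; rewrite !coefM !big_ord_recl !subn0 /=.
rewrite (eq_bigr (fun j : 'I_i => u`_(bump 0 j) * q`_(i - bump 0 j))) => [/addIr //|j _].
by rewrite IH //; have := ltn_ord j; rewrite /bump /=; lia.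
Qed.

End CongruenceModX.

Section QBinomial.
Variable R : comNzRingType.
Implicit Types (a x z w : R) (m n j : nat).

Definition qpoch a x n : R := \prod_(i < n) (1 - a * x ^+ i).

Lemma qpoch0 a x : qpoch a x 0 = 1.
Proof. exact: big_ord0. Qed.

Lemma qpochS a x n : qpoch a x n.+1 = qpoch a x n * (1 - a * x ^+ n).
Proof. exact: big_ord_recr. Qed.

Lemma qpochSl a x n : qpoch a x n.+1 = (1 - a) * qpoch (a * x) x n.
Proof.
rewrite /qpoch big_ord_recl mulr1; congr (_ * _); apply: eq_bigr => i _.
by rewrite lift0 exprS mulrA.
Qed.

Definition qint x n : R := \sum_(i < n) x ^+ i.

Lemma qintS x n : qint x n.+1 = qint x n + x ^+ n.
Proof. exact: big_ord_recr. Qed.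

Lemma mul_1sub_qint x n : (1 - x) * qint x n = 1 - x ^+ n.
Proof. by rewrite -[1 - x ^+ n]opprB subrX1 -mulNr opprB. Qed.

Lemma qintD x m n : qint x (m + n) = qint x m + x ^+ m * qint x n.
Proof.
rewrite /qint big_split_ord mulr_sumr /=; congr (_ + _).
by apply: eq_bigr => i _; rewrite exprD.
Qed.

Fixpoint qbin x n j : R :=
  match n, j with
  | _, 0 => 1
  | 0, _.+1 => 0
  | n'.+1, j'.+1 => x ^+ j * qbin x n' j + qbin x n' j'
  end.

Lemma qbin0 x n : qbin x n 0 = 1.
Proof. by case: n. Qed.

Lemma qbinS x n j : qbin x n.+1 j.+1 = x ^+ j.+1 * qbin x n j.+1 + qbin x n j.
Proof. by []. Qed.

Lemma qbin_small x n j : (n < j)%N -> qbin x n j = 0.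
Proof.
elim: n j => [|n IH] [|j] //= nj.
by rewrite !IH ?mulr0 ?addr0 //; lia.
Qed.

Lemma qbinn x n : qbin x n n = 1.
Proof. by elim: n => //= n ->; rewrite qbin_small // mulr0 add0r. Qed.

Lemma qbinSr x n j : (j <= n)%N ->
  qbin x n.+1 j.+1 = qbin x n j.+1 + x ^+ (n - j) * qbin x n j.
Proof.
elim: n j => [|n IH] [|j] jn //; first by rewrite /= mulr0 mul1r.
  by rewrite qbinS {1}IH // [qbin x n.+1 1]qbinS !qbin0 !subn0 !exprS; ring.
have [->|jn'] := eqVneq j n; first by rewrite qbinS (@qbin_small _ n.+1 n.+2) // subnn; ring.
rewrite qbinS {1}IH; last by lia.
rewrite [X in _ + X = _]IH // 2!qbinS.
have [m ->] : exists m, n = (j + m).+1 by exists (n - j.+1)%N; lia.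
by rewrite !subSS subSn ?leq_addr // addKn !exprS; ring.
Qed.

Lemma qbin_qpoch x m n :
  qbin x (m + n) m * qpoch x x m * qpoch x x n = qpoch x x (m + n).
Proof.
move: {2}(m + n)%N (erefl (m + n)%N) => l.
elim: l m n => [|l IH] [|m] [|n] //; rewrite ?add0n ?addn0 ?qbin0 ?qbinn ?qpoch0 ?mul1r ?mulr1 //.
move=> mnl.
have := IH m n.+1 ltac:(lia); have := IH m.+1 n ltac:(lia).
rewrite addSn !addnS !addSn (qbinS x (m + n).+1) (qpochS x x (m + n).+1).
move: (qpoch x x (m + n).+1) => P E1 E2.
transitivity (x ^+ m.+1 * (1 - x * x ^+ n) * P + (1 - x * x ^+ m) * P).
  by rewrite -{1}E1 -E2 !qpochS; ring.
by rewrite !exprS exprD; ring.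
Qed.

End QBinomial.

Section FiniteJacobi.
Variable R : comNzRingType.
Implicit Types z w : R.

Definition jacobi_term z w n : R := (-1) ^+ n * (z * w) ^+ 'C(n, 2) * z ^+ n.

Lemma jacobi_termS z w n :
  jacobi_term z w n.+1 = - (z * (z * w) ^+ n) * jacobi_term z w n.
Proof. by rewrite /jacobi_term binS bin1 exprD !exprS; ring. Qed.

(* The term j = i - b of the two-sided series sum_j (-1)^j (zw)^(j(j-1)/2) z^j, in which the
   negative powers of z have been absorbed by means of z^(-1) (zw) = w. *)
Definition jacobi_coef z w (b i : nat) : R :=
  if (b <= i)%N then jacobi_term z w (i - b) else jacobi_term w z (b - i).

Lemma jacobi_coef_shiftS z w b i : (i <= b)%N ->
  (z * w) ^+ i * jacobi_coef z w b.+1 i = - (w * (z * w) ^+ b) * jacobi_coef z w b i.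
Proof.
move=> ib; have [m ->] : exists m, b = (i + m)%N by exists (b - i)%N; lia.
rewrite /jacobi_coef; have [->|m0] := posnP m.
  rewrite addn0 leqnn ltnn subnn subSnn jacobi_termS /jacobi_term; ring.
rewrite !ifF; try lia.
by rewrite -addnS !addKn jacobi_termS exprD (mulrC w z); ring.
Qed.

Lemma jacobi_coef_indexS z w a b i : (i <= a + b)%N ->
  (z * w) ^+ (a + b - i) * jacobi_coef z w b i.+1 =
  - (z * (z * w) ^+ a) * jacobi_coef z w b i.
Proof.
rewrite /jacobi_coef => iab; case: (leqP b i) => bi.
  have [m im] : exists m, i = (b + m)%N by exists (i - b)%N; lia.
  rewrite leqW // im -addnS !addKn jacobi_termS.
  have [c ->] : exists c, a = (c + m)%N by exists (a - m)%N; lia.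
  by rewrite (_ : (c + m + b - (b + m) = c)%N); [rewrite exprD; ring|lia].
have [m ->] : exists m, b = (i.+1 + m)%N by exists (b - i.+1)%N; lia.
have -> : (a + (i.+1 + m) - i = a + m.+1)%N by lia.
have -> : (i.+1 + m - i = m.+1)%N by lia.
rewrite jacobi_termS exprD exprS (mulrC w z); case: m => [|m].
  by rewrite addn0 leqnn subnn /jacobi_term; ring.
by rewrite ifF ?addKn; [ring|lia].
Qed.

Lemma qpoch_jacobi_coef z w b :
  qpoch w (z * w) b = \sum_(i < b.+1) jacobi_coef z w b i * qbin (z * w) b i.
Proof.
elim: b => [|b IH]; first by rewrite qpoch0 big_ord1 /jacobi_coef /jacobi_term !mulr1.
rewrite qpochS {}IH mulrBr mulr1 [RHS]big_ord_recl qbin0.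
under [in RHS]eq_bigr => i _ do rewrite lift0 qbinS mulrDr.
rewrite big_split /= addrA [RHS]addrC; congr (_ + _).
transitivity (\sum_(i < b.+2) jacobi_coef z w b.+1 i * ((z * w) ^+ i * qbin (z * w) b i)).
  rewrite [RHS]big_ord_recr /= qbin_small // !mulr0 addr0 mulr_suml -sumrN.
  apply: eq_bigr => i _; rewrite [RHS]mulrCA [RHS]mulrA jacobi_coef_shiftS; last exact: leq_ord.
  by ring.
by rewrite big_ord_recl qbin0 mulr1.
Qed.

Theorem finite_jacobi z w a b :
  qpoch z (z * w) a * qpoch w (z * w) b =
  \sum_(i < (a + b).+1) jacobi_coef z w b i * qbin (z * w) (a + b) i.
Proof.
elim: a => [|a IH]; first by rewrite qpoch0 mul1r add0n qpoch_jacobi_coef.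
rewrite addSn qpochS mulrAC {}IH mulrBr mulr1 [RHS]big_ord_recl qbin0.
under [in RHS]eq_bigr => i _ do rewrite lift0 qbinSr ?leq_ord // mulrDr.
rewrite big_split /= addrA; congr (_ + _).
  rewrite [in LHS]big_ord_recl qbin0; congr (_ + _).
  by rewrite [RHS]big_ord_recr /= qbin_small // mulr0 addr0.
rewrite mulr_suml -sumrN; apply: eq_bigr => i _.
rewrite [RHS]mulrA [_ * _ ^+ _ in RHS]mulrC jacobi_coef_indexS; last exact: leq_ord.
by ring.
Qed.

End FiniteJacobi.

Section JacobiTripleProduct.
Variables (R : comNzRingType) (T : nat).
Implicit Types c m n : nat.

Lemma qpoch_XnE c m n :
  qpoch 'X^c 'X^m n = \prod_(i < n) (1 - 'X^(c + i * m)) :> {poly R}.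
Proof. by apply: eq_bigr => i _; rewrite -exprM -exprD mulnC. Qed.

Lemma coef0_qpoch (a x : {poly R}) n : a`_0 = 0 -> (qpoch a x n)`_0 = 1.
Proof.
by move=> a0; rewrite coef0_prod big1 // => i _; rewrite coefB coef1 coef0M a0 mul0r subr0.
Qed.

Lemma coef0_qint (x : {poly R}) n : x`_0 = 0 -> (0 < n)%N -> (qint x n)`_0 = 1.
Proof.
case: n => // n x0 _; rewrite /qint big_ord_recl coefD coef1 coef_sum big1 ?addr0 // => i _.
by rewrite exprS coef0M x0 mul0r.
Qed.

Lemma eqmodX_1subXn n : (T <= n)%N -> 1 - 'X^n = (1 : {poly R}) %[modX T].
Proof.
by move=> Tn; rewrite -['X^n]mulr1 eqmodX_Xn0 // subr0.
Qed.

Lemma qpoch_trunc c m n : (0 < c)%N -> (0 < m)%N -> (T <= n)%N ->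
  qpoch 'X^c 'X^m n = (qpoch 'X^c 'X^m T : {poly R}) %[modX T].
Proof.
move=> c0 m0; elim: n => [|n IH]; first by case: (T).
rewrite leq_eqVlt => /orP[/eqP-> //|Tn].
by rewrite qpochS IH // -exprM -exprD eqmodX_1subXn ?mulr1 //; nia.
Qed.

Lemma eqmodX_qbin_qpoch M m n : (0 < M)%N -> (T <= m)%N -> (T <= n)%N ->
  qbin 'X^M (m + n) m * qpoch 'X^M 'X^M T = (1 : {poly R}) %[modX T].
Proof.
move=> M0 Tm Tn; apply: (@eqmodX_mulI _ _ (qpoch 'X^M 'X^M T)).
  by rewrite coef0_qpoch ?coefXn ?(ltn_eqF M0) //; apply: lreg1.
rewrite mulr1 -[X in _ = X %[modX _]](@qpoch_trunc _ _ (m + n)) -?qbin_qpoch //; last by lia.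
by rewrite (@qpoch_trunc _ _ m) // (@qpoch_trunc _ _ n) // mulrC.
Qed.

Lemma eqmodX_jacobi_term0 p (w : {poly R}) n : (0 < p)%N -> (T <= n)%N ->
  jacobi_term 'X^p w n = 0 %[modX T].
Proof. by move=> p0 Tn; rewrite /jacobi_term mulrC -exprM eqmodX_Xn0 //; nia. Qed.

Lemma eqmodX_jacobi_term_qbin p r m n i (M := (p + r)%N) : (0 < p)%N ->
  (n < T -> T <= i /\ T <= m)%N ->
  jacobi_term 'X^p 'X^r n * qbin 'X^M (i + m) i * qpoch 'X^M 'X^M T =
  (jacobi_term 'X^p 'X^r n : {poly R}) %[modX T].
Proof.
move=> p0 bnd; case: (ltnP n T) => nT; last first.
  by rewrite -mulrA !(@eqmodX_jacobi_term0 _ _ n) ?mul0r.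
by have [Ti Tm] := bnd nT; rewrite -mulrA eqmodX_qbin_qpoch ?mulr1 // /M; lia.
Qed.

Theorem jacobi_triple_product p r (M := (p + r)%N) : (0 < p)%N -> (0 < r)%N ->
  qpoch 'X^p 'X^M T * qpoch 'X^r 'X^M T * qpoch 'X^M 'X^M T =
  \sum_(n < T) (jacobi_term 'X^p 'X^r n + jacobi_term 'X^r 'X^p n.+1 : {poly R}) %[modX T].
Proof.
move=> p0 r0; have M0 : (0 < M)%N by rewrite /M addn_gt0 p0.
pose h := (T + T)%N; have Th : (T <= h)%N by apply: leq_addr.
rewrite -(@qpoch_trunc _ _ h p0 M0 Th) -(@qpoch_trunc _ _ h r0 M0 Th).
have -> : 'X^M = 'X^p * 'X^r :> {poly R} by rewrite -exprD.
rewrite finite_jacobi -exprD -addnS big_split_ord /= addrC mulrDl !mulr_suml.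
rewrite big_split /=.
rewrite -(@eqmodX_sum_trunc _ _ (jacobi_term 'X^p 'X^r) h.+1); last 2 first.
- exact: leqW.
- by move=> n Tn; apply: eqmodX_jacobi_term0.
rewrite -(@eqmodX_sum_trunc _ _ (fun n => jacobi_term 'X^r 'X^p n.+1) h) //; last first.
  by move=> n Tn; apply: eqmodX_jacobi_term0 => //; apply: leqW.
apply: eqmodX_add; last rewrite (reindex_inj rev_ord_inj) /=.
  apply: eqmodX_sum => -[n /= nh] _; rewrite /jacobi_coef leq_addr addKn.
  rewrite (_ : (h + h = h + n + (h - n))%N); last by lia.
  by apply: eqmodX_jacobi_term_qbin => //; rewrite /h; lia.
apply: eqmodX_sum => -[n /= nh] _; rewrite /jacobi_coef ifF ?subKn //; last by lia.
rewrite (_ : (h + h = h - n.+1 + (h + n.+1))%N); last by lia.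
rewrite /M addnC; apply: eqmodX_jacobi_term_qbin => //; rewrite /h; lia.
Qed.

End JacobiTripleProduct.

Section HalfTheta.
Variables (R : comNzRingType) (kappa delta : R).
Implicit Types t u v : R.

Definition half_theta T N t : R :=
  \sum_(n < T) (-1) ^+ n * kappa ^+ (n * (N + n)) * delta ^+ 'C(n, 2) * t ^+ n *
    qpoch (delta ^+ n.+1) delta N.

(* For kappa = q^K, delta = q^d, u = q^S and u v = kappa delta, this is a partial sum of
   (q^d; q^d)_oo J_{K/d, S/d}(q^(dN); q^d), where
     J_{k, i}(x; q) =
       sum_n (-1)^n x^(kn) q^((2k+1)n(n+1)/2 - in) (1 - x^i q^((2n+1)i)) /
             ((q; q)_n (x q^(n+1); q)_oo)
   is Andrews' function; the two terms come from expanding 1 - x^i q^((2n+1)i). *)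
Definition andrews_theta T N u v : R :=
  half_theta T N v - u ^+ N.+1 * half_theta T N (kappa * delta * u).

Lemma half_thetaS T N t : half_theta T N.+1 t =
  half_theta T N (kappa * t) - delta ^+ N.+1 * half_theta T N (kappa * delta * t).
Proof.
rewrite /half_theta mulr_sumr -sumrB; apply: eq_bigr => n _.
by rewrite qpochS addSn mulnS !exprMn !exprD !exprS; ring.
Qed.

Lemma half_theta_sub T N t : half_theta T.+1 N t - half_theta T.+1 N (delta * t) =
  - (kappa ^+ N.+1 * t) * half_theta T N.+1 (kappa * delta * t).
Proof.
rewrite /half_theta -sumrB big_ord_recl subrr add0r mulr_sumr; apply: eq_bigr => n _.
rewrite lift0 qpochSl -[delta ^+ n.+1 * delta]exprSr binS bin1 !exprMn.
rewrite (_ : (n.+1 * (N + n.+1) = N.+1 + n + n * (N.+1 + n))%N); last by nia.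
by rewrite !exprD !exprS; ring.
Qed.

End HalfTheta.

Section AndrewsTheta.
Variables (R : comNzRingType) (T K d : nat) (K_gt0 : (0 < K)%N).
Implicit Types t u v : {poly R}.

Local Notation G := (@half_theta {poly R} 'X^K 'X^d T).
Local Notation F := (@andrews_theta {poly R} 'X^K 'X^d T).

Lemma eqmodX_half_theta_sub N t : G N t - G N ('X^d * t) =
  - ('X^K ^+ N.+1 * t) * G N.+1 ('X^K * 'X^d * t) %[modX T].
Proof.
have last_term s : half_theta 'X^K 'X^d T.+1 N s = G N s %[modX T].
  rewrite /half_theta big_ord_recr /= -[_ * 'X^K ^+ _]mulrC -!mulrA -exprM.
  by rewrite eqmodX_Xn0 ?addr0 //; nia.
by rewrite -!last_term half_theta_sub.
Qed.

Lemma andrews_theta_shift N u v : u * v = 'X^K ->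
  F N (u * 'X^d) v - F N u (v * 'X^d) = u ^+ N.+1 * F N.+1 v (u * 'X^d) %[modX T].
Proof.
move=> uv; rewrite /andrews_theta.
transitivity (G N v - G N ('X^d * v) + u ^+ N.+1 * G N.+1 (u * 'X^d)).
  apply: eqmodXW; rewrite half_thetaS [v * _]mulrC.
  by rewrite (_ : 'X^K * (u * 'X^d) = 'X^K * 'X^d * u) ?exprMn; ring.
rewrite eqmodX_half_theta_sub; apply: eqmodXW.
by rewrite -[in X in - (X * v)]uv exprMn !exprS; ring.
Qed.

(* Formally the shift relation at [u'^-1] and ['X^K * u'], since [F N u'^-1 ('X^(K + d) * u')]
   equals [- u' ^- N.+1 * F N u' ('X^K * u)]. *)
Lemma andrews_theta_reflect N u u' : u * u' = 'X^d ->
  u' ^+ N.+1 * F N u ('X^K * u') + F N u' ('X^K * u) = F N.+1 ('X^K * u') u %[modX T].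
Proof.
move=> uu'; rewrite /andrews_theta.
transitivity (u' ^+ N.+1 * (G N ('X^K * u') - G N ('X^d * ('X^K * u'))) + G N.+1 u).
  apply: eqmodXW; rewrite half_thetaS -uu' exprMn.
  by rewrite (_ : u * u' * ('X^K * u') = 'X^K * (u * u') * u'); ring.
rewrite eqmodX_half_theta_sub; apply: eqmodXW.
by rewrite exprMn !exprS; ring.
Qed.

End AndrewsTheta.

Lemma mulnn_bin2 n : (n * n = 'C(n, 2).*2 + n)%N.
Proof. by elim: n => // n IH; rewrite binS bin1; nia. Qed.

Section AndrewsJ.
Variables (R : comNzRingType) (T K d : nat) (K_gt0 : (0 < K)%N).
Implicit Types N S U : nat.

Definition andrewsJ N S : {poly R} := andrews_theta 'X^K 'X^d T N 'X^S 'X^(K + d - S).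

Lemma andrewsJ0 N : andrewsJ N 0 = 0.
Proof. by rewrite /andrewsJ /andrews_theta expr0 expr1n mulr1 mul1r subn0 exprD subrr. Qed.

Lemma andrewsJ_step N U : (U <= K)%N ->
  andrewsJ N (U + d) = andrewsJ N U + 'X^(U * N.+1) * andrewsJ N.+1 (K - U) %[modX T].
Proof.
move=> UK; rewrite /andrewsJ !exprM.
rewrite (_ : (K + d - (U + d) = K - U)%N); last by lia.
rewrite (_ : (K + d - U = K - U + d)%N); last by lia.
rewrite (_ : (K + d - (K - U) = U + d)%N); last by lia.
rewrite !exprD -andrews_theta_shift //; last by rewrite -exprD subnKC.
by rewrite addrC subrK.
Qed.

Lemma andrewsJ_reflect N S : (S <= d)%N ->
  'X^((d - S) * N.+1) * andrewsJ N S + andrewsJ N (d - S) =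
  andrewsJ N.+1 (K + (d - S)) %[modX T].
Proof.
move=> Sd; rewrite /andrewsJ exprM.
rewrite (_ : (K + d - S = K + (d - S))%N); last by lia.
rewrite (_ : (K + d - (d - S) = K + S)%N); last by lia.
rewrite (_ : (K + d - (K + (d - S)) = S)%N); last by lia.
by rewrite !['X^(K + _)]exprD andrews_theta_reflect // -exprD subnKC.
Qed.

Lemma andrewsJ_large N S : (0 < S)%N -> (T <= N)%N ->
  andrewsJ N S = qpoch 'X^d 'X^d N %[modX T].
Proof.
move=> S0 TN; rewrite /andrewsJ /andrews_theta -exprM eqmodX_Xn0 ?subr0; last by nia.
case: T TN => // T' TN; rewrite /half_theta big_ord_recl !mul1r.
rewrite (@eqmodX_sum _ _ _ _ _ _ (fun=> 0)) => [|i _]; first by rewrite big1 ?addr0.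
by rewrite lift0 -exprM -!mulrA mulrCA eqmodX_Xn0 //; nia.
Qed.

Lemma andrewsJ_triple_product S (M := (2 * K + d)%N) : (0 < S)%N -> (S <= K + d)%N ->
  andrewsJ 0 S =
  qpoch 'X^S 'X^M T * qpoch 'X^(M - S) 'X^M T * qpoch 'X^M 'X^M T %[modX T].
Proof.
move=> S0 SKd; have SM : (M - S + S = M)%N by rewrite /M; lia.
have MS0 : (0 < M - S)%N by rewrite /M; lia.
have := @jacobi_triple_product R T (M - S) S MS0 S0; rewrite SM => E.
rewrite [qpoch 'X^S _ _ * _]mulrC {}E; apply: eqmodXW.
rewrite /andrewsJ /andrews_theta /half_theta expr1 mulr_sumr -sumrB.
apply: eq_bigr => n _; rewrite /jacobi_term !qpoch0 !mulr1 -!exprD -!exprM SM addnC subnKC.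
  rewrite [(-1) ^+ n.+1]exprS mulN1r !mulNr -!mulrA ['X^S * _]mulrCA -!exprD.
  rewrite binS bin1 addn0 mulnn_bin2; congr (_ * 'X^_ - _ * 'X^_); rewrite /M; nia.
by rewrite /M; lia.
Qed.

End AndrewsJ.

Section TailPartitions.
Variables (d K : nat).
Implicit Types (j k n N S : nat) (s : seq nat).

Let geq_trans : ssrbool.transitive geq := rev_trans leq_trans.

Lemma phi_cat_nseq s k N i : phi (s ++ nseq k N) i = (phi s i + (N == i) * k)%N.
Proof. by rewrite /phi count_cat count_nseq. Qed.

Lemma phi_gt s N : all (ltn N) s -> phi s N = 0%N.
Proof. by move=> sN; apply/count_memPn/negP => /(allP sN); rewrite /= ltnn. Qed.

Lemma filter_gt_cat_nseq s k N : all (ltn N) s ->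
  [seq x <- s ++ nseq k N | (N < x)%N] = s.
Proof. by move=> /all_filterP sN; rewrite filter_cat sN filter_nseq ltnn cats0. Qed.

Lemma sorted_geq_cat_nseq s k N :
  all (ltn N) s -> sorted geq (s ++ nseq k N) = sorted geq s.
Proof.
move=> sN; rewrite !(sorted_pairwise geq_trans) pairwise_cat.
have -> : pairwise geq (nseq k N) by elim: k => //= k ->; rewrite all_nseq /= leqnn orbT.
rewrite andbT andbC; have -> : allrel geq s (nseq k N); last by rewrite andbT.
by apply/allrelP => x y /(allP sN) /ltnW Nx /nseqP[-> _].
Qed.

Lemma partition_split N s : sorted geq s -> all (leq N) s ->
  s = [seq x <- s | (N < x)%N] ++ nseq (phi s N) N.
Proof.
move=> s_sorted sN; have gtN : all (ltn N) [seq x <- s | (N < x)%N] by apply: filter_all.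
have le_nseq : [seq x <- s | ~~ (N < x)%N] = nseq (phi s N) N.
  have /all_pred1P -> : all (pred1 N) [seq x <- s | ~~ (N < x)%N].
    by apply/allP => x; rewrite mem_filter => /andP[xN /(allP sN) Nx] /=; lia.
  rewrite size_filter; congr nseq; apply: eq_in_count => x /(allP sN) /=; lia.
apply: (sorted_eq geq_trans) => //.
- by move=> x y /andP[yx xy]; apply/anti_leq/andP.
- by rewrite sorted_geq_cat_nseq // (sorted_filter geq_trans).
by rewrite -le_nseq perm_sym; apply/permPl/perm_filterC.
Qed.

Lemma is_partition_cat_nseq s k N n : (0 < N)%N -> all (ltn N) s ->
  is_partition n (s ++ nseq k N) <-> (k * N <= n)%N /\ is_partition (n - k * N) s.
Proof.
move=> N0 sN; rewrite /is_partition sorted_geq_cat_nseq // all_cat sumn_cat sumn_nseq.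
rewrite mulnC all_nseq N0 orbT andbT.
split=> [[? [? sn]]|[kn [? [? sn]]]]; first by do !split=> //; lia.
by do !split=> //; lia.
Qed.

Definition tail_partition j N S n s : Prop :=
  [/\ is_partition n s, all (fun x => N < x <= N + j)%N s,
      forall i, (N < i)%N -> (phi s i + phi s i.+1 < K)%N,
      (phi s N.+1 < S)%N &
      forall i, (N < i)%N -> ~~ odd i -> (d %| phi s i)%N].

Lemma tail_partition_gt j N S n s : tail_partition j N S n s -> all (ltn N) s.
Proof. by case=> _ sN _ _ _; apply: sub_all sN => x /andP[]. Qed.

Lemma tail_partition_cat_nseq j N S n s k : all (ltn N.+1) s ->
  tail_partition j.+1 N S n (s ++ nseq k N.+1) <->
  [/\ (k < S)%N, odd N ==> (d %| k)%N, (k * N.+1 <= n)%N &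
      tail_partition j N.+1 (K - k) (n - k * N.+1) s].
Proof.
move=> sN; have phi0 := phi_gt sN.
have phiE i : (N.+1 < i)%N -> phi (s ++ nseq k N.+1) i = phi s i.
  by move=> Ni; rewrite phi_cat_nseq ltn_eqF // addn0.
have phiN : phi (s ++ nseq k N.+1) N.+1 = k.
  by rewrite phi_cat_nseq phi0 eqxx mul1n.
have partE := is_partition_cat_nseq k n (ltn0Sn N) sN.
rewrite /tail_partition phiN; split=> [[/partE[kn sP] sj sK kS sd]|[kS kd kn [sP sj sK sS sd]]].
  split=> //; first by apply/implyP => oN; rewrite -phiN; apply: sd; rewrite //= negbK.
  split=> //.
  - apply/allP => x xs; have := allP sN x xs.
    by have := allP sj x; rewrite mem_cat xs => /(_ isT) /=; lia.
  - by move=> i Ni; rewrite -!phiE ?sK //; lia.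
  - by have := sK N.+1 (leqnn _); rewrite phiN phiE //; lia.
  - by move=> i Ni oi; rewrite -phiE // sd //; lia.
split=> //.
- exact/partE.
- by rewrite all_cat all_nseq (sub_all _ sj) => [|x] /=; lia.
- move=> i; rewrite leq_eqVlt => /predU1P[<-|Ni]; last by rewrite !phiE ?sK //; lia.
  by rewrite phiN phiE //; lia.
- move=> i; rewrite leq_eqVlt => /predU1P[<-|Ni]; last by rewrite phiE //; apply: sd.
  by rewrite phiN /= negbK => oN; apply: (implyP kd).
Qed.

Fixpoint tails j N S n : seq (seq nat) :=
  if j is j'.+1 then
    [seq s ++ nseq k N.+1 |
      k <- [seq k <- iota 0 S | (odd N ==> (d %| k)) && (k * N.+1 <= n)]%N,
      s <- tails j' N.+1 (K - k) (n - k * N.+1)]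
  else if (0 < S)%N && (n == 0)%N then [:: [::]] else [::].

Hypothesis K_gt0 : (0 < K)%N.

Lemma tailsP j N S n s : reflect (tail_partition j N S n s) (s \in tails j N S n).
Proof.
elim: j N S n s => [|j IH] N S n s.
  apply: (iffP idP) => [|[[_ [_ sn]] sN _ S0 _]] /=.
    by case: ifP => // /andP[S0 /eqP->]; rewrite inE => /eqP->.
  have s0 : s = [::] by case: s sN {sn S0} => //= x s /andP[]; lia.
  by move: sn S0; rewrite s0 /= => <- ->.
apply: (iffP allpairsPdep) => [[k [s' []]]|sT].
  rewrite mem_filter mem_iota add0n => /andP[/andP[kd kn] kS] s'T ->.
  move: s'T => /IH s'T; apply/tail_partition_cat_nseq => //.
  exact: tail_partition_gt s'T.
have [[s_sorted _] _ _ _ _] := sT.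
have sE : s = [seq x <- s | (N.+1 < x)%N] ++ nseq (phi s N.+1) N.+1.
  exact: partition_split s_sorted (tail_partition_gt sT).
move: sT; rewrite {1}sE tail_partition_cat_nseq ?filter_all // => -[kS kd kn /IH s'T].
exists (phi s N.+1), [seq x <- s | (N.+1 < x)%N]; split=> //.
by rewrite mem_filter mem_iota kd kn.
Qed.

Lemma tails_uniq j N S n : uniq (tails j N S n).
Proof.
elim: j N S n => [|j IH] N S n /=; first by case: ifP.
apply: allpairs_uniq_dep => [|k _|]; [by rewrite filter_uniq ?iota_uniq|exact: IH|].
move=> p p' /allpairsPdep[k [s [_ /tailsP/tail_partition_gt sN ->]]].
move=> /allpairsPdep[k' [s' [_ /tailsP/tail_partition_gt sN' ->]]] /= E.
have := congr1 (phi^~ N.+1) E; rewrite !phi_cat_nseq eqxx !mul1n !phi_gt // !add0n => ->.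
by have := congr1 (filter (ltn N.+1)) E; rewrite !filter_gt_cat_nseq // => ->.
Qed.

Lemma size_tails_uniq j N S n (l : seq (seq nat)) : uniq l ->
  (forall s, s \in l <-> tail_partition j N S n s) -> size l = size (tails j N S n).
Proof.
move=> l_uniq lP; apply/perm_size/uniq_perm => // [|s]; first exact: tails_uniq.
by apply/idP/tailsP => /lP.
Qed.

End TailPartitions.

Section TailGeneratingFunction.
Variables (R : comNzRingType) (d K : nat).
Implicit Types (i j m n N S : nat).

Fixpoint tailgf j N S : {poly R} :=
  if j is j'.+1 then
    \sum_(k < S | odd N ==> (d %| k)%N) 'X^(k * N.+1) * tailgf j' N.+1 (K - k)
  else (0 < S)%N%:R.

Lemma coef_tailgf j N S n : (tailgf j N S)`_n = (size (tails d K j N S n))%:R.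
Proof.
elim: j N S n => [|j IH] N S n /=.
  by rewrite -polyC_natr coefC; case: n S => [|n] [|S].
rewrite size_allpairs_dep sumnE big_map big_filter -[S in iota 0 S]subn0.
rewrite -/(index_iota 0 S) big_mkord big_mkcondr natr_sum coef_sum.
apply: eq_bigr => k _; rewrite coefXnM ltnNge IH.
by case: leqP.
Qed.

Lemma tailgf0 j N : tailgf j N 0 = 0.
Proof. by case: j => [|j] //=; rewrite big_ord0. Qed.

Lemma tailgfS j N S : tailgf j.+1 N S.+1 =
  tailgf j.+1 N S +
  (if odd N ==> (d %| S)%N then 'X^(S * N.+1) * tailgf j N.+1 (K - S) else 0).
Proof. by rewrite /= big_mkcond big_ord_recr -big_mkcond. Qed.

Lemma tailgf_roundup j N S m : odd N -> (S <= d * m)%N -> (d * m < S + d)%N ->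
  tailgf j N S = tailgf j N (d * m).
Proof.
move=> oN Sdm; have [i] : exists i, (S + i = d * m)%N.
  by exists (d * m - S)%N; rewrite subnKC.
elim: i S {Sdm} => [|i IH] S; first by rewrite addn0 => ->.
rewrite addnS -addSn => SE ltS; rewrite -(IH S.+1) //; last by lia.
case: j {IH} => [|j].
  have S0 : (0 < S)%N by case: m SE ltS => [|m]; rewrite ?muln0 ?mulnS; lia.
  by rewrite /= S0.
rewrite tailgfS oN ifF ?addr0 //; apply/negP => /dvdnP[y Sy].
by case: (ltnP y m) => ym; nia.
Qed.

Lemma tailgf_odd j N m : odd N -> (0 < d)%N ->
  tailgf j.+1 N (d * m + d) =
  tailgf j.+1 N (d * m) + 'X^(d * m * N.+1) * tailgf j N.+1 (K - d * m).
Proof.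
move=> oN d0; rewrite -mulnSr -(@tailgf_roundup _ _ (d * m).+1) //; [|nia|nia].
by rewrite tailgfS dvdn_mulr // implybT.
Qed.

Lemma tailgf_even j N S i m : ~~ odd N ->
  (K <= S + d * m)%N -> (S + i + d * m <= K + d)%N ->
  tailgf j.+1 N (S + i) = tailgf j.+1 N S +
  'X^(S * N.+1) * qint 'X^(N.+1) i * tailgf j N.+1 (d * m).
Proof.
move=> oN KS; elim: i => [|i IH] Si; first by rewrite addn0 /qint big_ord0 mulr0 mul0r addr0.
rewrite addnS tailgfS (negbTE oN) IH; last by lia.
rewrite (@tailgf_roundup _ _ (K - (S + i)) m) ?oN //; try lia.
by rewrite qintS mulnDl exprD -exprM [(i * _)%N]mulnC /=; ring.
Qed.

Lemma tailgf_interpolate j N S i m : ~~ odd N -> (S + d * m = K)%N -> (i <= d)%N ->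
  (1 - 'X^(N.+1) ^+ d) * tailgf j.+1 N (S + i) =
  ('X^(N.+1) ^+ i - 'X^(N.+1) ^+ d) * tailgf j.+1 N S +
  (1 - 'X^(N.+1) ^+ i) * tailgf j.+1 N (S + d).
Proof.
move=> oN SK id; rewrite !(@tailgf_even _ _ _ _ m) //; try lia.
move: (tailgf _ _ S) => A0; rewrite -[_ ^+ i - _](subrKA 1) -[_ ^+ i - 1]opprB.
by rewrite -!mul_1sub_qint; ring.
Qed.

End TailGeneratingFunction.

Section TailRecurrence.
Variables (R : comNzRingType) (d k e : nat).
Hypotheses (d_gt0 : (0 < d)%N) (ed : e = d \/ (2 * e)%N = d).

Local Notation K := (d * k + e)%N.
Local Notation A := (@tailgf R d K).
Local Notation J := (@andrewsJ R).

Definition tail_bound N a : nat := (d * a + ~~ odd N * e)%N.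

Definition tail_weight N : {poly R} := \prod_(i < N | ~~ odd i) qint 'X^(i.+1) d.

Definition euler_denom H : {poly R} := qpoch 'X^(2 * d) 'X^(2 * d) H * qpoch 'X^1 'X^2 H.

Lemma tail_bound_odd N a : odd N -> tail_bound N a = (d * a)%N.
Proof. by rewrite /tail_bound => ->; rewrite addn0. Qed.

Lemma tail_bound_even N a : ~~ odd N -> tail_bound N a = (d * a + e)%N.
Proof. by rewrite /tail_bound => ->; rewrite mul1n. Qed.

Lemma tail_weight_odd N : odd N -> tail_weight N.+1 = tail_weight N.
Proof. by move=> oN; rewrite /tail_weight big_mkcond big_ord_recr /= oN mulr1 -big_mkcond. Qed.

Lemma tail_weight_even N : ~~ odd N ->
  tail_weight N.+1 = tail_weight N * qint 'X^(N.+1) d.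
Proof. by move=> oN; rewrite /tail_weight big_mkcond big_ord_recr /= oN -big_mkcond. Qed.

Lemma euler_denom_weight H :
  euler_denom H * tail_weight (2 * H) = qpoch 'X^d 'X^d (2 * H).
Proof.
elim: H => [|H IH]; first by rewrite /euler_denom /tail_weight !qpoch0 big_ord0 !mulr1.
rewrite (_ : (2 * H.+1 = (2 * H).+2)%N); last by lia.
rewrite tail_weight_odd ?tail_weight_even ?qpochS; try by rewrite /= oddM.
rewrite -{}IH /euler_denom !qpochS.
have := mul_1sub_qint ('X^((2 * H).+1) : {poly R}) d.
rewrite -!exprM -!exprD.
rewrite (_ : (1 + 2 * H = (2 * H).+1)%N); last by lia.
rewrite (_ : (2 * d + 2 * d * H = d + d * (2 * H).+1)%N); last by lia.
rewrite (_ : ((2 * H).+1 * d = d + d * (2 * H))%N); last by lia.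
by move=> <-; ring.
Qed.

Lemma tailgf_boundS j N a : (a <= k)%N ->
  tail_weight N * A j.+1 N (tail_bound N a.+1) =
  tail_weight N * A j.+1 N (tail_bound N a) +
  'X^(tail_bound N a * N.+1) * (tail_weight N.+1 * A j N.+1 (tail_bound N.+1 (k - a))).
Proof.
move=> ak; have dak : (d * a <= d * k)%N by rewrite leq_pmul2l.
case: (boolP (odd N)) => oN.
  rewrite !(tail_bound_odd _ oN) tail_bound_even ?oddS ?negbK // tail_weight_odd // mulnSr.
  rewrite tailgf_odd // mulnBr (_ : (K - d * a = d * k - d * a + e)%N); last by lia.
  by ring.
rewrite !(tail_bound_even _ oN) tail_bound_odd ?oddS // tail_weight_even // mulnSr addnAC.
rewrite (@tailgf_even _ _ _ _ _ _ _ (k - a)) ?mulnBr //; try lia.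
by ring.
Qed.

Lemma tailgf_interpolate0 j a i : (0 < j)%N -> (a <= k)%N -> (i <= d)%N ->
  (1 - 'X^d) * A j 0 (d * a + e + i) =
  ('X^i - 'X^d) * A j 0 (d * a + e) + (1 - 'X^i) * A j 0 (d * a.+1 + e).
Proof.
case: j => // j _ ak; rewrite (_ : d * a.+1 + e = d * a + e + d)%N; last by rewrite mulnS; lia.
have := @tailgf_interpolate R d K j 0 (d * a + e) i (k - a) isT.
by rewrite expr1; apply; rewrite addnAC -mulnDr subnKC.
Qed.

Lemma tailgf_bound0 j N : ~~ odd N ->
  qint 'X^(N.+1) d * (tail_weight N * A j.+1 N (tail_bound N 0)) =
  qint 'X^(N.+1) e * (tail_weight N.+1 * A j N.+1 (tail_bound N.+1 k.+1)).
Proof.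
move=> oN; rewrite tail_weight_even // tail_bound_even // tail_bound_odd ?oddS // muln0.
rewrite (@tailgf_even _ _ _ _ _ 0 e k.+1) //; try by rewrite mulnS; lia.
by rewrite tailgf0; ring.
Qed.

(* Reflection at [S = e] also involves [J N (d - e)], which is [0] if [e = d] and [J N e] if
   [2 * e = d]. *)
Lemma andrewsJ_bound0 T N :
  qint 'X^(N.+1) d * J T K d N e = qint 'X^(N.+1) e * J T K d N.+1 (d * k.+1) %[modX T].
Proof.
have K0 : (0 < K)%N by lia.
have := @andrewsJ_reflect R T K d K0 N e ltac:(lia).
rewrite (_ : (K + (d - e) = d * k.+1)%N); last by rewrite mulnS; lia.
move=> <-; apply: eqmodXW; case: ed => [->|ed2].
  by rewrite subnn andrewsJ0 mul0n mul1r addr0.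
rewrite (_ : (d - e = e)%N) -?[in qint _ d]ed2; last by lia.
by rewrite mul2n -addnn qintD -exprM [(_.+1 * e)%N]mulnC; ring.
Qed.

Theorem tailgf_andrewsJ T H j N a :
  (T <= 2 * H)%N -> (N + j = 2 * H)%N -> (a <= k.+1)%N ->
  euler_denom H * (tail_weight N * A j N (tail_bound N a)) = J T K d N (tail_bound N a) %[modX T].
Proof.
move=> TH; have K0 : (0 < K)%N by lia.
elim: j N a => [|j IHj] N a.
  rewrite addn0 => -> _; rewrite tail_bound_even ?oddM //= (_ : (0 < _)%N); last by lia.
  by rewrite mulr1 euler_denom_weight andrewsJ_large //; lia.
move=> Nj; elim: a => [|a IHa] ak.
  case: (boolP (odd N)) => oN.
    by rewrite tail_bound_odd // muln0 andrewsJ0 tailgf0 !mulr0.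
  apply: (@eqmodX_mulI _ _ (qint 'X^(N.+1) d)).
    by rewrite coef0_qint ?coefXn //; apply: lreg1.
  rewrite mulrCA tailgf_bound0 // mulrCA IHj; [|lia|by []].
  by rewrite (tail_bound_even _ oN) tail_bound_odd ?oddS // muln0 andrewsJ_bound0.
rewrite tailgf_boundS // mulrDr IHa; last exact: ltnW.
rewrite mulrCA IHj; [|lia|lia].
have dak : (d * a <= d * k)%N by rewrite leq_pmul2l.
rewrite (_ : tail_bound N.+1 (k - a) = K - tail_bound N a)%N; last first.
  by rewrite /tail_bound /= mulnBr; case: odd; lia.
rewrite -andrewsJ_step //; last by rewrite /tail_bound; case: odd; lia.
by rewrite /tail_bound mulnSr addnAC.
Qed.

End TailRecurrence.

Section TruncatedPowerSeries.
Variable T : nat.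
Implicit Types f g : ps.

Definition trunc f : {poly rat} := \poly_(i < T) f i.

Lemma trunc_psadd f g : trunc (psadd f g) = trunc f + trunc g %[modX T].
Proof. by move=> i iT; rewrite coefD !coef_poly iT. Qed.

Lemma trunc_psmul f g : trunc (psmul f g) = trunc f * trunc g %[modX T].
Proof.
move=> i iT; rewrite coefM coef_poly iT; apply: eq_bigr => j _.
by rewrite !coef_poly !ifT //; have := ltn_ord j; lia.
Qed.

Lemma trunc_pspoly p : trunc (pspoly p) = p %[modX T].
Proof. by move=> i iT; rewrite coef_poly iT. Qed.

Lemma trunc_qpinf c m : (0 < c)%N -> (0 < m)%N ->
  trunc (qpinf c m) = qpoch 'X^c 'X^m T %[modX T].
Proof.
move=> c0 m0 i iT; rewrite coef_poly iT /qpinf -qpoch_XnE.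
by rewrite -(qpoch_trunc _ c0 m0 iT).
Qed.

Lemma trunc_qp3 c1 c2 m : (0 < c1)%N -> (0 < c2)%N -> (0 < m)%N ->
  trunc (qp3 c1 c2 m) =
  qpoch 'X^c1 'X^m T * qpoch 'X^c2 'X^m T * qpoch 'X^m 'X^m T %[modX T].
Proof. by move=> c10 c20 m0; rewrite !trunc_psmul !trunc_qpinf // mulrA. Qed.

Lemma size_psinv_seq f n : size (psinv_seq f n) = n.+1.
Proof. by elim: n => //= n IH; rewrite size_rcons IH. Qed.

Lemma nth_psinv_seq f n i : (i <= n)%N -> nth 0 (psinv_seq f n) i = psinv f i.
Proof.
elim: n => [|n IH]; first by case: i.
rewrite leq_eqVlt => /orP[/eqP-> //|i_n] /=.
by rewrite nth_rcons size_psinv_seq i_n IH.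
Qed.

Lemma psinvS f n :
  psinv f n.+1 = - (f 0%N)^-1 * \sum_(i < n.+1) f i.+1 * psinv f (n - i)%N.
Proof.
rewrite {1}/psinv /= nth_rcons size_psinv_seq ltnn eqxx; congr (_ * _).
by apply: eq_bigr => i _; rewrite nth_psinv_seq // leq_subr.
Qed.

Lemma trunc_psinv f : f 0%N != 0 -> trunc f * trunc (psinv f) = 1 %[modX T].
Proof.
move=> f0 i iT; rewrite -(trunc_psmul f (psinv f) iT) coef_poly iT coef1 /psmul.
rewrite big_ord_recl subn0; case: i {iT} => [|i].
  by rewrite big_ord0 addr0 /psinv /= divff.
rewrite psinvS mulrA mulrN divff // mulN1r addrC; apply/eqP; rewrite subr_eq0; apply/eqP.
by apply: eq_bigr => j _; rewrite lift0.
Qed.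

Lemma eqmodX_psinv_combination (D A A0 A1 p q u : {poly rat}) (X0 X1 : ps) : u`_0 != 0 ->
  u * A = p * A0 + q * A1 ->
  D * A0 = trunc X0 %[modX T] -> D * A1 = trunc X1 %[modX T] ->
  D * A = trunc (psadd (psmul (pspoly p) (psmul (psinv (pspoly u)) X0))
                       (psmul (pspoly q) (psmul (psinv (pspoly u)) X1))) %[modX T].
Proof.
move=> u0 uA E0 E1; apply: (@eqmodX_mulI _ _ u); first exact/lregP.
have uI : u * trunc (psinv (pspoly u)) = 1 %[modX T].
  by rewrite -[X in X * _](trunc_pspoly u) trunc_psinv.
rewrite trunc_psadd !trunc_psmul !trunc_pspoly.
transitivity (u * trunc (psinv (pspoly u)) * (p * trunc X0 + q * trunc X1)); last first.
  by apply: eqmodXW; ring.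
by rewrite uI mul1r mulrCA uA mulrDr mulrCA E0 mulrCA E1.
Qed.

End TruncatedPowerSeries.

Lemma coef_psmul_psinv (D X : ps) (A : {poly rat}) n : D 0%N != 0 ->
  trunc n.+1 D * A = trunc n.+1 X %[modX n.+1] -> A`_n = psmul (psinv D) X n.
Proof.
move=> D0 DA; suff E : A = trunc n.+1 (psmul (psinv D) X) %[modX n.+1].
  by rewrite E // coef_poly leqnn.
apply: (@eqmodX_mulI _ _ (trunc n.+1 D)).
  by rewrite coef_poly; apply/lregP.
by rewrite DA trunc_psmul mulrA trunc_psinv // mul1r.
Qed.

Lemma trunc_euler_denom d T : (0 < d)%N ->
  trunc T (psmul (qpinf (2 * d) (2 * d)) (qpinf 1 2)) = euler_denom rat d T %[modX T].
Proof. by move=> d0; rewrite trunc_psmul !trunc_qpinf //; lia. Qed.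

Lemma qpinf_coef0 c m : (0 < c)%N -> qpinf c m 0%N = 1.
Proof. by move=> c0; rewrite /qpinf -qpoch_XnE coef0_qpoch // coefXn; case: c c0. Qed.

Lemma psmul_qpinf_coef0_neq0 c1 m1 c2 m2 : (0 < c1)%N -> (0 < c2)%N ->
  psmul (qpinf c1 m1) (qpinf c2 m2) 0%N != 0.
Proof. by move=> c10 c20; rewrite /psmul big_ord1 !qpinf_coef0 // mulr1 oner_eq0. Qed.

Lemma dB_tail_partition d K L n j s : (n <= j)%N ->
  is_partition n s /\ dB_cond d K L s <-> tail_partition d K j 0 L n s.
Proof.
move=> nj; split=> [[sP [sK [sL sd]]]|[sP sN sK sL sd]].
  split=> // [|i i0 io]; last first.
    have -> : i = (2 * i./2)%N by rewrite mul2n even_halfK.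
    by apply: sd; rewrite half_gt0; case: i i0 io => [|[]].
  have [_ [s0 sn]] := sP; apply/allP => x xs; rewrite (allP s0) //= add0n.
  apply: leq_trans nj; rewrite -sn sumnE (big_rem x) //=; apply: leq_addr.
split=> //; split=> //; split=> // i i0; apply: sd; first by lia.
by rewrite oddM.
Qed.

Lemma size_dB d K L n (l : seq (seq nat)) j : (0 < K)%N -> (n <= j)%N -> uniq l ->
  (forall s, s \in l <-> is_partition n s /\ dB_cond d K L s) ->
  (size l)%:R = (tailgf rat d K j 0 L)`_n.
Proof.
move=> K0 nj l_uniq lP; rewrite coef_tailgf; congr (_ %:R).
by apply: size_tails_uniq => // s; rewrite lP; apply: dB_tail_partition.
Qed.

Lemma tailgf_qp3 d k e T a c : (0 < d)%N -> e = d \/ (2 * e)%N = d ->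
  (a <= k.+1)%N -> (c + d * a = 2 * d * k + e + d)%N ->
  euler_denom rat d T * tailgf rat d (d * k + e) (2 * T) 0 (d * a + e) =
  trunc T (qp3 (d * a + e) c (2 * d * k + 2 * e + d)) %[modX T].
Proof.
move=> d0 ed ak ca; have dak : (d * a <= d * k.+1)%N by rewrite leq_pmul2l.
have := @tailgf_andrewsJ rat d k e d0 ed T T (2 * T) 0 a ltac:(lia) ltac:(lia) ak.
rewrite /tail_bound /tail_weight big_ord0 mul1r mul1n => ->.
rewrite andrewsJ_triple_product; try lia.
rewrite trunc_qp3; try lia.
apply: eqmodXW; congr (qpoch _ 'X^_ _ * qpoch 'X^_ 'X^_ _ * qpoch 'X^_ 'X^_ _); lia.
Qed.

Theorem theorem3p1 (a k d e f : nat) :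
  (1 <= a <= k)%N -> (1 <= d <= k)%N -> (1 <= f <= d)%N ->
  (e = d \/ (2 * e)%N = d) ->
  let M := (2 * d * k + 2 * e + d)%N in
  let P := psinv (psmul (qpinf (2 * d) (2 * d)) (qpinf 1 2)) in
  let T0 := qp3 (d * a + e) (2 * d * k - d * a + e + d) M in
  let iD := psinv (pspoly (1 - 'X^d)) in
  forall (n : nat) (l : seq (seq nat)),
    uniq l ->
    (forall s, s \in l <-> is_partition n s /\ dB_cond d (d * k + e) (d * a + f) s) ->
    ((f < e)%N ->
       (size l)%:R =
       psmul P
         (psadd
            (psmul (pspoly (1 - 'X^(d - e + f))) (psmul iD T0))
            (psmul (pspoly ('X^(d - e + f) - 'X^d))
               (psmul iD (qp3 (d * (a - 1) + e) (2 * d * k - d * a + e + 2 * d) M)))) n)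
    /\
    (f = e -> (size l)%:R = psmul P T0 n)
    /\
    ((e < f)%N ->
       (size l)%:R =
       psmul P
         (psadd
            (psmul (pspoly ('X^(f - e) - 'X^d)) (psmul iD T0))
            (psmul (pspoly (1 - 'X^(f - e)))
               (psmul iD (qp3 (d * (a + 1) + e) (2 * d * k - d * a + e) M)))) n).
Proof.
move=> /andP[a0 ak] /andP[d0 dk] /andP[f0 fd] ed M P T0 iD n l l_uniq lP.
have dak : (d * a <= d * k)%N by rewrite leq_pmul2l.
rewrite (@size_dB d (d * k + e) (d * a + f) n l (2 * n.+1)) //; [|lia|lia].
have u0 : (1 - 'X^d : {poly rat})`_0 != 0.
  by rewrite coefB coef1 coefXn (ltn_eqF d0) subr0 oner_eq0.
have product b c bk cE := @tailgf_qp3 d k e n.+1 b c d0 ed bk cE.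
have Ea := product a (2 * d * k - d * a + e + d)%N ltac:(lia) ltac:(lia).
split=> [fe|]; [|split=> [->|ef]];
  (apply: coef_psmul_psinv; first by rewrite psmul_qpinf_coef0_neq0 ?muln_gt0);
  rewrite trunc_euler_denom //.
- apply: (eqmodX_psinv_combination u0 _ Ea (product (a - 1)%N _ _ _)); try nia.
  rewrite (_ : (d * a + f = d * (a - 1) + e + (d - e + f))%N); last by nia.
  by rewrite tailgf_interpolate0 ?subn1 ?prednK // 1?addrC //; lia.
- apply: (eqmodX_psinv_combination u0 _ Ea (product (a + 1)%N _ _ _)); try lia.
  rewrite (_ : (d * a + f = d * a + e + (f - e))%N); last by lia.
  by rewrite tailgf_interpolate0 ?addn1 //; lia.
Qed.
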